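(* Let $w$ be a positive graph function that is vertex $\lambda$-multiplicative for some fixed $\lambda>0$. Let $G=(V,E)$ be a finite simple graph with $|V|=n$, and let $\mathrm{tw}(G)$ denote the tree-width of $G$. Then the mixing time of the single site flip chain $\mathcal{M}'$ on $G$ with weight function $w$ satisfies $$\tau(\varepsilon)=O\left(n^{2+4(\mathrm{tw}(G)+1)|\log_2\lambda|}\,\log(1/\varepsilon)\right).$$
   Context: All graphs are finite and simple. A graph function $w$ assigns a real number to every graph, isomorphic graphs receiving the same number; here $w$ is assumed positive: $w(G)>0$ for every graph $G$. $G[S]$ is the subgraph of $G$ induced by $S$. Write $\hat\lambda:=\max\{\lambda,1/\lambda\}$. Vertex cuts. For $G=(V,E)$, a vertex cut $K\subseteq V$ separates sets $V_1$ and $V_2$ if $(V_1,K,V_2)$ is a partition of $V$ (parts may be empty) and no edge of $E$ joins a vertex of $V_1$ to a vertex of $V_2$. Vertex $\lambda$-multiplicativity. For fixed $\lambda>0$, $w$ is vertex $\lambda$-multiplicative if for every graph $G=(V,E)$ and every vertex cut $K$ separating sets $V_1$ and $V_2$ in $G$, $$\hat\lambda^{-|K|}\le\frac{w(G[V_1])\,w(G[V_2\cup K])}{w(G)}\le\hat\lambda^{|K|}.$$ Single site flip chain $\mathcal{M}'$ on $G=(V,E)$: the state space is $\Omega'=2^V$. From $X_t\subseteq V$, pick $v\in V$ uniformly at random, let $S=X_t\oplus\{v\}$ ($\oplus$ is symmetric difference), and set $X_{t+1}=S$ with probability $\frac12\min\{1,w(G[S])/w(G[X_t])\}$ and $X_{t+1}=X_t$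 otherwise. Its unique stationary distribution $\pi'$ satisfies $\pi'(S)\propto w(G[S])$. Mixing time. $\|\nu-\nu'\|_{TV}=\frac12\sum_{H\in\Omega'}|\nu(H)-\nu'(H)|$, and with $P'$ the transition matrix, $\tau(\varepsilon)=\max_{H\in\Omega'}\min\{t: \|P'^t(H,\cdot)-\pi'\|_{TV}\le\varepsilon\}$. In the bound, $0<\varepsilon\le 1/2$, and the implied constant may depend on $w$, $\lambda$ and $\mathrm{tw}(G)$, but not otherwise on $G$ and not on $\varepsilon$. *)

(* Defs.v *)
From HB Require Import structures.
From mathcomp Require Import all_boot all_order all_algebra.
From mathcomp Require Import boolp classical_sets reals constructive_ereal ereal.
From mathcomp Require Import exp.

Set Implicit Arguments.
Unset Strict Implicit.
Unset Printing Implicit Defensive.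

Import Order.TTheory GRing.Theory Num.Theory.

Local Open Scope ring_scope.

Record sgraph := SGraph {
  vertex :> finType;
  edge : rel vertex;
  edge_sym : symmetric edge;
  edge_irr : irreflexive edge }.

Arguments edge {s}.

Definition isomorphic (G H : sgraph) : Prop :=
  exists f : G -> H, bijective f /\ forall x y, edge (f x) (f y) = edge x y.

Section Induced.
Variables (G : sgraph) (S : {set G}).

Definition induced_edge : rel {x : G | x \in S} :=
  [rel x y | edge (val x) (val y)].

Fact induced_edge_sym : symmetric induced_edge.
Proof. by move=> x y; rewrite /induced_edge /= edge_sym. Qed.

Fact induced_edge_irr : irreflexive induced_edge.
Proof. by move=> x; rewrite /induced_edge /= edge_irr. Qed.

Definition induced : sgraph := SGraph induced_edge_sym induced_edge_irr.

End Induced.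

(* The graph without vertices counts as connected here but is not a tree. *)
Definition connected_graph (G : sgraph) : Prop :=
  forall x y : G, connect edge x y.

(* [:: x; y] with x adjacent to y satisfies ucycle, hence the bound 2. *)
Definition acyclic (G : sgraph) : Prop :=
  forall c : seq G, ucycle edge c -> (size c <= 2)%N.

Definition is_tree (T : sgraph) : Prop :=
  [/\ (0 < #|T|)%N, connected_graph T & acyclic T].

Record tree_decomposition (G T : sgraph) (B : T -> {set G}) : Prop := {
  td_tree : is_tree T;
  td_vertex : forall x : G, exists t, x \in B t;
  td_edge : forall x y : G, edge x y -> exists t, (x \in B t) && (y \in B t);
  td_connected : forall x : G, connected_graph (induced [set t | x \in B t]) }.

(* The predecessor is truncated, so the graph without vertices gets width 0. *)
Definition td_width (G T : sgraph) (B : T -> {set G}) : nat :=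
  (\max_(t : T) #|B t|).-1.

Definition has_td_of_width (G : sgraph) (k : nat) : Prop :=
  exists (T : sgraph) (B : T -> {set G}),
    tree_decomposition B /\ td_width B = k.

Fact treewidth_subproof (G : sgraph) : exists k, `[< has_td_of_width G k >].
Proof.
have sym1 : symmetric (fun _ _ : unit => false) by [].
have irr1 : irreflexive (fun _ _ : unit => false) by [].
pose T := SGraph sym1 irr1; pose B (_ : T) := [set: G].
exists (td_width B); apply/asboolP; exists T, B; split=> //.
split=> [|x|x y _|x].
- split; first by rewrite card_unit.
  + by move=> [] [].
  + by case=> [|[] [|[] c]] //=; rewrite /ucycle /= andbF.
- by exists tt; rewrite inE.
- by exists tt; rewrite !inE.
- by move=> [[] i] [[] j]; rewrite (bool_irrelevance i j) connect0.
Qed.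

Definition treewidth (G : sgraph) : nat := ex_minn (treewidth_subproof G).

(* Either of V1, K, V2 may be empty. *)
Definition separates (G : sgraph) (V1 K V2 : {set G}) : Prop :=
  [/\ V1 :|: K :|: V2 = [set: G],
      [&& [disjoint V1 & K], [disjoint V1 & V2] & [disjoint K & V2]]
    & forall x y, x \in V1 -> y \in V2 -> ~~ edge x y].

Section Chain.
Variable R : realType.
Implicit Types (w : sgraph -> R) (lambda : R).

Definition graph_function w : Prop :=
  forall G H : sgraph, isomorphic G H -> w G = w H.

Definition positive_graph_function w : Prop := forall G : sgraph, 0 < w G.

Definition vertex_multiplicative lambda w : Prop :=
  let lhat := Num.max lambda lambda^-1 in
  forall (G : sgraph) (V1 K V2 : {set G}), separates V1 K V2 ->
    lhat ^- #|K| <= w (induced V1) * w (induced (V2 :|: K)) / w G <= lhat ^+ #|K|.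

Definition log2 (x : R) : R := ln x / ln 2.

Definition flip (T : finType) (X : {set T}) (v : T) : {set T} :=
  (X :\: [set v]) :|: ([set v] :\: X).

(* The factor 1/2 of the lazy chain is included. *)
Definition flip_accept w (G : sgraph) (X S : {set G}) : R :=
  2^-1 * Num.min 1 (w (induced S) / w (induced X)).

(* On the graph without vertices this is the zero kernel. *)
Definition flip_chain w (G : sgraph) (X Y : {set G}) : R :=
  \sum_(v : G) #|G|%:R^-1 *
    (flip_accept w X (flip X v) * (Y == flip X v)%:R +
     (1 - flip_accept w X (flip X v)) * (Y == X)%:R).

Definition flip_stationary w (G : sgraph) (S : {set G}) : R :=
  w (induced S) / \sum_(X : {set G}) w (induced X).

Fact flip_chain_stationary w (G : sgraph) (Y : {set G}) :
  positive_graph_function w -> (0 < #|G|)%N ->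
  \sum_(X : {set G}) flip_stationary w X * flip_chain w X Y =
  flip_stationary w Y.
Proof.
move=> w0 n0.
have flipK v : involutive (fun X : {set G} => flip X v).
  by move=> X; apply/setP => x; rewrite !inE; case: (x == v); case: (x \in X).
have eq_flip v (X Z : {set G}) : (Z == flip X v) = (X == flip Z v).
  by apply/eqP/eqP => ->; rewrite flipK.
have bal (X Z : {set G}) : w (induced X) * flip_accept w X Z =
                           w (induced Z) * flip_accept w Z X.
  rewrite /flip_accept !(mulrCA _ 2^-1) !minr_pMr ?ltW ?w0 // !mulr1.
  by rewrite !(mulrC (w _) (w _ / _)) !mulfVK ?gt_eqF ?w0 // minC.
rewrite /flip_stationary /flip_chain.
under eq_bigr do rewrite mulrAC mulr_sumr.
rewrite -mulr_suml; congr (_ / _); rewrite exchange_big /=.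
rewrite (eq_bigr (fun=> #|G|%:R^-1 * w (induced Y))) => [|v _].
  rewrite sumr_const -[LHS]mulr_natl mulrA mulfV ?mul1r // pnatr_eq0.
  by rewrite -lt0n.
under eq_bigr do rewrite mulrCA mulrDr.
rewrite -mulr_sumr big_split /=; congr (_ * _).
rewrite (bigD1 (flip Y v)) //= big1 => [|X]; last first.
  by rewrite eq_flip => /negPf ->; rewrite !mulr0.
rewrite flipK eqxx mulr1 bal addr0.
rewrite (bigD1 Y) //= big1 => [|X]; last first.
  by rewrite eq_sym => /negPf ->; rewrite !mulr0.
by rewrite eqxx mulr1 addr0 -mulrDr addrC subrK mulr1.
Qed.

Fixpoint iter_kernel (Omega : finType) (P : Omega -> Omega -> R) (t : nat) :
    Omega -> Omega -> R :=
  if t is t'.+1 then fun x y => \sum_z iter_kernel P t' x z * P z y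
  else fun x y => (x == y)%:R.

Definition tv_dist (Omega : finType) (mu nu : Omega -> R) : R :=
  2^-1 * \sum_x `|mu x - nu x|.

(* Extended-real valued: a starting state from which the distance never gets
   below eps contributes the infimum of the empty set, +oo. *)
Definition mixing_time (Omega : finType) (P : Omega -> Omega -> R)
    (pi : Omega -> R) (eps : R) : \bar R :=
  \big[Order.max/-oo%E]_(x : Omega)
    ereal_inf [set t%:R%:E | t in
               [set t : nat | tv_dist (iter_kernel P t x) pi <= eps]]%classic.

Definition flip_mixing_time w (G : sgraph) (eps : R) : \bar R :=
  mixing_time (@flip_chain w G) (@flip_stationary w G) eps.

End Chain.

(* Main.v *)
(** A Poincare inequality replaces canonical paths.  Deleting a vertex v from the
    domain changes the weight w(G[X]) into the product w(G[X - v]) w(G[X /\ v])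
    up to a factor lhat = max(lambda, 1/lambda), hence costs a factor lhat^2 in
    the Poincare constant; across parts of the domain without edges between them
    w is exactly multiplicative, and the constant tensorizes.  Every set of
    vertices is cut by some bag of a tree decomposition into components of at
    most half its size, so that deleting bags recursively removes all vertices
    in log2 n + 1 rounds of at most tw + 1 deletions, which bounds the constant
    by O(n^(2 (tw + 1) |log2 lambda|)).  The chain picks one of n vertices and
    log (1 / pi(X)) = O(n), which accounts for the factor n^2. *)

Require Import Defs.
From HB Require Import structures.
From mathcomp Require Import all_boot all_order all_algebra.
From mathcomp Require Import boolp classical_sets reals constructive_ereal ereal.
From mathcomp Require Import sequences exp.
From mathcomp Require Import ring lra.
Import fintype boot.finset.

Set Implicit Arguments.
Unset Strict Implicit.
Unset Printing Implicit Defensive.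

Import Order.TTheory GRing.Theory Num.Theory.

Local Open Scope ring_scope.

(** * Poincare inequalities on the subsets of a finite set *)

Section WeightedSums.
Variables (R : realFieldType) (I : finType).
Implicit Types (P : pred I) (a x : I -> R).

Lemma sum_gt0 P a i : P i -> (forall j, 0 < a j) -> 0 < \sum_(j | P j) a j.
Proof.
move=> Pi a0; rewrite (bigD1 i) //= ltr_wpDr ?a0 //.
by apply: sumr_ge0 => j _; apply: ltW.
Qed.

(** Parallel axis identity: [m] is the weighted mean of [x], described without dividing by the total
    weight. *)
Lemma weighted_pythagoras P a x (c m : R) :
  (\sum_(i | P i) a i) * m = \sum_(i | P i) a i * x i ->
  \sum_(i | P i) a i * (x i - c) ^+ 2 =
  \sum_(i | P i) a i * (x i - m) ^+ 2 + (\sum_(i | P i) a i) * (m - c) ^+ 2.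
Proof.
move=> mE.
have E e : \sum_(i | P i) a i * (x i - e) ^+ 2 =
    \sum_(i | P i) a i * x i ^+ 2 - 2 * e * (\sum_(i | P i) a i * x i)
    + (\sum_(i | P i) a i) * e ^+ 2.
  rewrite !mulr_sumr mulr_suml -sumrB -big_split /=.
  by apply: eq_bigr => i _; ring.
by rewrite (E c) (E m) -mE; ring.
Qed.

Lemma weighted_jensen P a x (m : R) : (forall i, P i -> 0 <= a i) ->
  (\sum_(i | P i) a i) * m = \sum_(i | P i) a i * x i ->
  (\sum_(i | P i) a i) * m ^+ 2 <= \sum_(i | P i) a i * x i ^+ 2.
Proof.
move=> a0 /(weighted_pythagoras 0).
under eq_bigr do rewrite subr0.
move=> ->; rewrite subr0 ler_wpDl //.
by apply: sumr_ge0 => i Pi; rewrite mulr_ge0 ?sqr_ge0 ?a0.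
Qed.

End WeightedSums.

Section Poincare.
Variables (R : realFieldType) (T : finType).
Implicit Types (U X : {set T}) (om : {set T} -> R) (f : {set T} -> R).

(** Up to a factor, the Dirichlet form of the Metropolis flip chain of weight [om] on the subsets of
    [U]: the minimum is proportional to the stationary flow along a flip. Each flip is counted from
    both of its ends. *)
Definition dirichlet U om f : R :=
  \sum_(v in U) \sum_(X : {set T} | X \subset U)
    Num.min (om X) (om (flip X v)) * (f (flip X v) - f X) ^+ 2.

(** [A] is an inverse spectral gap, up to normalization. With an existential centre [c] in place of
    the mean, a change of weight can keep the same [c]. *)
Definition poincare U om (A : R) : Prop :=
  forall f, exists c : R,
    \sum_(X : {set T} | X \subset U) om X * (f X - c) ^+ 2 <= A * dirichlet U om f.

Lemma in_flip X v x : (x \in flip X v) = (x == v) (+) (x \in X).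
Proof. by rewrite !inE; case: (x == v); case: (x \in X). Qed.

Lemma flipK v : involutive (fun X => flip X v).
Proof. by move=> X; apply/setP => x; rewrite !in_flip addKb. Qed.

Lemma flip_sub U X v : v \in U -> (flip X v \subset U) = (X \subset U).
Proof.
move=> vU; apply/subsetP/subsetP => XU x xX.
  have [->//|xv] := eqVneq x v.
  by apply: XU; rewrite in_flip (negPf xv).
have [->//|xv] := eqVneq x v.
by apply: XU; move: xX; rewrite in_flip (negPf xv).
Qed.

Lemma flipUl X1 X2 v : v \notin X2 -> flip (X1 :|: X2) v = flip X1 v :|: X2.
Proof.
move=> vX; apply/setP => x; rewrite in_flip in_setU [RHS]in_setU in_flip.
have [->|_] /= := eqVneq x v; first by rewrite (negPf vX) !orbF.
by [].
Qed.

Lemma dirichlet_ge0 U om f : (forall X, 0 < om X) -> 0 <= dirichlet U om f.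
Proof.
move=> om0; apply: sumr_ge0 => v _; apply: sumr_ge0 => X _.
by rewrite mulr_ge0 ?sqr_ge0 // le_min !ltW.
Qed.

Lemma poincare_le U om A A' : (forall X, 0 < om X) -> A <= A' ->
  poincare U om A -> poincare U om A'.
Proof.
move=> om0 AA' H f; have [c Hc] := H f; exists c.
by apply: (le_trans Hc); rewrite ler_wpM2r ?dirichlet_ge0.
Qed.

(* The mean of f minimizes the left-hand side over all c. *)
Lemma poincare_mean U om A f m : (forall X, 0 < om X) -> poincare U om A ->
  (\sum_(X : {set T} | X \subset U) om X) * m =
    \sum_(X : {set T} | X \subset U) om X * f X ->
  \sum_(X : {set T} | X \subset U) om X * (f X - m) ^+ 2 <= A * dirichlet U om f.
Proof.
move=> om0 H mE; have [c] := H f.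
rewrite (weighted_pythagoras c mE) => /(le_trans _); apply.
rewrite ler_wpDr // mulr_ge0 ?sqr_ge0 //.
by apply: sumr_ge0 => X _; apply: ltW.
Qed.

(** Holley-Stroock comparison: one factor [b] is lost in the variance and one in the Dirichlet
    form. *)
Lemma poincare_perturb U om om' A b : (forall X, 0 < om X) ->
  (forall X, 0 < om' X) -> 0 <= A -> 0 <= b ->
  (forall X, X \subset U -> om X <= b * om' X) ->
  (forall X, X \subset U -> om' X <= b * om X) ->
  poincare U om' A -> poincare U om (b ^+ 2 * A).
Proof.
move=> om0 om'0 A0 b0 le1 le2 H f; have [c Hc] := H f; exists c.
apply: (@le_trans _ _ (b * (A * dirichlet U om' f))).
  apply: le_trans (ler_wpM2l b0 Hc); rewrite mulr_sumr; apply: ler_sum => X XU.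
  by rewrite [leRHS]mulrA ler_wpM2r ?sqr_ge0 ?le1.
rewrite expr2 -!mulrA ler_wpM2l // mulrCA ler_wpM2l //.
rewrite mulr_sumr; apply: ler_sum => v vU.
rewrite mulr_sumr; apply: ler_sum => X XU.
rewrite [leRHS]mulrA ler_wpM2r ?sqr_ge0 // minr_pMr //.
by rewrite le_min !ge_min le2 // le2 ?flip_sub // orbT.
Qed.

Lemma poincare0 om A : poincare set0 om A.
Proof.
move=> f; exists (f set0); rewrite /dirichlet big_set0 mulr0.
rewrite big1 // => X; rewrite subset0 => /eqP ->.
by rewrite subrr expr0n mulr0.
Qed.

Lemma sum_subset_setU U1 U2 (F : {set T} -> R) : [disjoint U1 & U2] ->
  \sum_(X : {set T} | X \subset U1 :|: U2) F X =
  \sum_(X1 : {set T} | X1 \subset U1) \sum_(X2 : {set T} | X2 \subset U2)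
     F (X1 :|: X2).
Proof.
move=> dis; rewrite pair_big /=.
rewrite (reindex_onto (fun p : {set T} * {set T} => p.1 :|: p.2)
          (fun X => (X :&: U1, X :&: U2))) /=; last first.
  by move=> X XU; rewrite -setIUr; apply/setIidPl.
apply: eq_bigl => -[X1 X2] /=; apply/andP/andP.
  move=> [_ /eqP [<- <-]]; by rewrite !subsetIr.
move=> [s1 s2]; split; first by rewrite setUSS.
apply/eqP; congr pair.
- rewrite setIUl (setIidPl s1) (_ : X2 :&: U1 = set0) ?setU0 //.
  by apply/eqP; rewrite setI_eq0 disjoint_sym; apply: disjointWr dis.
- rewrite setIUl (setIidPl s2) (_ : X1 :&: U2 = set0) ?set0U //.
  by apply/eqP; rewrite setI_eq0; apply: disjointWl dis.
Qed.

(** Tensorization. The variance splits into the variances inside the fibres over [X2] and the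
    variance of the fibre mean [m]; [H1] bounds the former and [H2], applied to [m], the latter. *)
Lemma poincare_prod U1 U2 om om1 om2 A : (forall X, 0 < om1 X) ->
  (forall X, 0 < om2 X) -> 0 <= A -> [disjoint U1 & U2] ->
  (forall X1 X2, X1 \subset U1 -> X2 \subset U2 ->
     om (X1 :|: X2) = om1 X1 * om2 X2) ->
  poincare U1 om1 A -> poincare U2 om2 A -> poincare (U1 :|: U2) om A.
Proof.
move=> om1_gt0 om2_gt0 A0 dis omE H1 H2 f.
pose Z := \sum_(X : {set T} | X \subset U1) om1 X.
have Z0 : 0 < Z by apply: sum_gt0 (sub0set _) om1_gt0.
pose m X2 := (\sum_(X1 : {set T} | X1 \subset U1) om1 X1 * f (X1 :|: X2)) / Z.
have mE X2 : Z * m X2 = \sum_(X1 : {set T} | X1 \subset U1) om1 X1 * f (X1 :|: X2).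
  by rewrite mulrC divfK // gt_eqF.
have [c Hc] := H2 m; exists c.
have notin1 v X1 : v \in U2 -> X1 \subset U1 -> v \notin X1.
  move=> vU s; apply/negP => vX; have := disjointFl dis vU.
  by rewrite (subsetP s).
have notin2 v X2 : v \in U1 -> X2 \subset U2 -> v \notin X2.
  move=> vU s; apply/negP => vX; have := disjointFr dis vU.
  by rewrite (subsetP s).
have -> : dirichlet (U1 :|: U2) om f =
    \sum_(X2 : {set T} | X2 \subset U2)
       om2 X2 * dirichlet U1 om1 (fun X1 => f (X1 :|: X2)) +
    \sum_(X1 : {set T} | X1 \subset U1)
       om1 X1 * dirichlet U2 om2 (fun X2 => f (X1 :|: X2)).
  rewrite /dirichlet.
  under eq_bigr do rewrite (sum_subset_setU _ dis).
  rewrite (bigID (fun v => v \in U1)) /=; congr (_ + _).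
    rewrite (eq_bigl (fun v => v \in U1)); last first.
      by move=> v; rewrite in_setU; case: (v \in U1); rewrite //= ?andbF.
    under [RHS]eq_bigr do rewrite mulr_sumr.
    rewrite [RHS]exchange_big /=; apply: eq_bigr => v vU.
    under [RHS]eq_bigr do rewrite mulr_sumr.
    rewrite [RHS]exchange_big /=; apply: eq_bigr => X1 s1.
    apply: eq_bigr => X2 s2.
    rewrite flipUl ?(notin2 v X2) // !omE ?flip_sub //.
    by rewrite -minr_pMl ?ltW // [RHS]mulrA (mulrC (om2 X2)).
  rewrite (eq_bigl (fun v => v \in U2)); last first.
    move=> v; rewrite in_setU; case vU: (v \in U1) => //=.
      by rewrite (disjointFr dis vU).
    by rewrite andbT.
  under [RHS]eq_bigr do rewrite mulr_sumr.
  rewrite [RHS]exchange_big /=; apply: eq_bigr => v vU.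
  apply: eq_bigr => X1 s1; rewrite mulr_sumr; apply: eq_bigr => X2 s2.
  rewrite setUC flipUl ?(notin1 v X1) // ![_ :|: X1]setUC !omE ?flip_sub //.
  by rewrite -minr_pMr ?ltW // -mulrA.
rewrite sum_subset_setU // exchange_big /= mulrDr.
rewrite (eq_bigr (fun X2 => om2 X2 *
      (\sum_(X1 : {set T} | X1 \subset U1) om1 X1 * (f (X1 :|: X2) - m X2) ^+ 2)
    + Z * (om2 X2 * (m X2 - c) ^+ 2))); last first.
  move=> X2 s2; rewrite [Z * _]mulrCA -mulrDr -(weighted_pythagoras c (mE X2)) mulr_sumr.
  by apply: eq_bigr => X1 s1; rewrite omE // [om1 X1 * om2 X2]mulrC -[LHS]mulrA.
rewrite big_split /=; apply: lerD.
  rewrite mulr_sumr; apply: ler_sum => X2 s2; rewrite mulrCA.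
  rewrite ler_wpM2l ?(ltW (om2_gt0 _)) //.
  exact: (poincare_mean (f := fun X1 => f (X1 :|: X2)) om1_gt0 H1 (mE X2)).
rewrite -mulr_sumr; apply: le_trans (ler_wpM2l (ltW Z0) Hc) _.
rewrite mulrCA ler_wpM2l // /dirichlet mulr_sumr.
under [leRHS]eq_bigr do rewrite mulr_sumr.
rewrite exchange_big /=; apply: ler_sum => v vU.
under [leRHS]eq_bigr do rewrite mulr_sumr.
rewrite exchange_big mulr_sumr /=; apply: ler_sum => X2 s2.
rewrite mulrCA.
under [leRHS]eq_bigr do rewrite mulrCA.
rewrite -mulr_sumr ler_wpM2l ?le_min ?(ltW (om2_gt0 _)) //=.
(* A flip in [U2] changes [m] by the mean of the changes of [f] along the fibre, so Jensen bounds
   its square. *)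
apply: (@weighted_jensen _ _ _ om1 (fun X1 => f (X1 :|: flip X2 v) - f (X1 :|: X2))).
  by move=> *; apply: ltW.
rewrite mulrBr !mE -sumrB; by apply: eq_bigr => X1 _; rewrite mulrBr.
Qed.

(** On two points of weights [p] and [q] the variance is [p * q / (p + q)] times the squared
    difference, and [p * q / (p + q) <= min p q]. The single flip enters the Dirichlet form twice,
    hence the constant one half. *)
Lemma poincare1 om v : (forall X, 0 < om X) -> poincare [set v] om 2^-1.
Proof.
move=> om0 f; pose p := om set0; pose q := om [set v].
have p0 : 0 < p := om0 _; have q0 : 0 < q := om0 _.
exists ((p * f set0 + q * f [set v]) / (p + q)).
have E (F : {set T} -> R) : \sum_(X : {set T} | X \subset [set v]) F X = F set0 + F [set v].
  rewrite (bigD1 set0) ?sub0set //=; congr (_ + _).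
  rewrite (bigD1 [set v]) /= ?subxx //=; last first.
    by apply/eqP => /setP/(_ v); rewrite !inE eqxx.
  rewrite big1 ?addr0 // => X /andP[/andP[]]; rewrite subset1.
  by case/orP => /eqP ->; rewrite eqxx.
rewrite /dirichlet big_set1 !E.
have f0 : flip set0 v = [set v].
  by apply/setP => x; rewrite in_flip !inE addbF.
have f1 : flip [set v] v = set0.
  by apply/setP => x; rewrite in_flip !inE addbb.
rewrite f0 f1 -/p -/q minC -/p -/q.
set a := f set0; set b := f [set v].
have pq0 : p + q != 0 by rewrite gt_eqF ?addr_gt0.
have -> : p * (a - (p * a + q * b) / (p + q)) ^+ 2 +
    q * (b - (p * a + q * b) / (p + q)) ^+ 2 = (p * q / (p + q)) * (b - a) ^+ 2.
  by field.
have -> : 2^-1 * (Num.min q p * (b - a) ^+ 2 + Num.min q p * (a - b) ^+ 2)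
   = Num.min q p * (b - a) ^+ 2 by field.
rewrite ler_wpM2r ?sqr_ge0 // ler_pdivrMr ?addr_gt0 //.
rewrite minr_pMl ?(ltW (addr_gt0 p0 q0)) // le_min; apply/andP; split; nra.
Qed.

End Poincare.

(** * Multiplicativity on induced subgraphs *)

Lemma induced_imset (G H : sgraph) (h : G -> H) (A : {set G}) : injective h ->
  (forall x y, edge (h x) (h y) = edge x y) ->
  isomorphic (induced A) (induced (h @: A)).
Proof.
move=> h_inj h_edge.
pose f (x : induced A) : induced (h @: A) :=
  exist _ (h (val x)) (imset_f h (valP x)).
exists f; split=> [|x y]; last exact: h_edge.
apply: inj_card_bij => [x y /(congr1 val) /= /h_inj /val_inj //|].
by rewrite !card_sig card_imset.
Qed.

Section Weight.
Variables (R : realType) (w : sgraph -> R) (lambda : R).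
Hypotheses (w_inv : graph_function w) (w_pos : positive_graph_function w)
           (w_mul : vertex_multiplicative lambda w) (lambda_gt0 : 0 < lambda).
Let lhat := Num.max lambda lambda^-1.

Lemma lhat_ge1 : 1 <= lhat.
Proof.
rewrite le_max; have [//|l1] := leP 1 lambda.
by rewrite invf_ge1 // ltW.
Qed.

(** Multiplicativity is assumed for cuts of a whole graph only. It is applied to the graph [H]
    induced on the union of the three sets, and isomorphism invariance carries the weights back to
    [G]. *)
Lemma induced_multiplicative (G : sgraph) (V1 K V2 : {set G}) :
  [disjoint V1 & K] -> [disjoint V1 & V2] -> [disjoint K & V2] ->
  (forall x y, x \in V1 -> y \in V2 -> ~~ edge x y) ->
  lhat ^- #|K| <=
    w (induced V1) * w (induced (V2 :|: K)) / w (induced (V1 :|: K :|: V2))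
  <= lhat ^+ #|K|.
Proof.
move=> d1 d2 d3 sep; set X := V1 :|: K :|: V2; pose H := induced X.
pose lft (A : {set G}) : {set H} := val @^-1: A.
have lftK (A : {set G}) : A \subset X -> val @: lft A = A.
  move=> AX; apply/setP => x; apply/imsetP/idP => [[y]|xA].
    by rewrite inE => ? ->.
  by exists (exist _ x (subsetP AX _ xA)); rewrite ?inE.
have wE (A : {set G}) : A \subset X -> w (induced A) = w (induced (lft A)).
  move=> AX; rewrite -{1}(lftK A AX); apply/esym/w_inv.
  by apply: induced_imset => //; exact: val_inj.
have s1 : V1 \subset X by rewrite /X -setUA subsetUl.
have s2 : V2 \subset X by rewrite subsetUr.
have sK : K \subset X by rewrite /X setUAC subsetUr.
have cK : #|K| = #|lft K| by rewrite -{1}(lftK _ sK) card_imset //; exact: val_inj.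
have -> : w (induced (V2 :|: K)) = w (induced (lft V2 :|: lft K)).
  by rewrite wE ?subUset ?s2 ?sK // /lft preimsetU.
rewrite (wE V1 s1) cK; apply: w_mul; split.
- by apply/setP => x; rewrite !inE; move: (valP x); rewrite !inE.
- have dl (A B : {set G}) : [disjoint A & B] -> [disjoint lft A & lft B].
    by rewrite -!setI_eq0 => /eqP AB; rewrite -preimsetI AB preimset0.
  by rewrite !dl.
- by move=> x y; rewrite !inE; apply: sep.
Qed.

(** An empty cut makes both bounds equal to 1. *)
Lemma induced_disjoint (G : sgraph) (V1 V2 : {set G}) : [disjoint V1 & V2] ->
  (forall x y, x \in V1 -> y \in V2 -> ~~ edge x y) ->
  w (induced (V1 :|: V2)) = w (induced V1) * w (induced V2).
Proof.
move=> d sep; have := @induced_multiplicative G V1 set0 V2.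
rewrite -!setI_eq0 setI0 set0I eqxx setI_eq0 => /(_ isT d isT sep).
rewrite cards0 expr0 invr1 !setU0 -eq_le => /eqP e.
by rewrite -[RHS](divfK (lt0r_neq0 (w_pos (induced (V1 :|: V2))))) -e mul1r.
Qed.

(** The cut is [X :&: [set v]], with an empty second side; having at most one vertex, it costs at
    most one factor [lhat]. *)
Lemma induced_setD1 (G : sgraph) (X : {set G}) (v : G) :
  w (induced X) <= lhat * (w (induced (X :\ v)) * w (induced (X :&: [set v]))) /\
  w (induced (X :\ v)) * w (induced (X :&: [set v])) <= lhat * w (induced X).
Proof.
have := @induced_multiplicative G (X :\ v) (X :&: [set v]) set0.
have d : (X :\ v) :&: (X :&: [set v]) == set0.
  apply/eqP/setP => x; rewrite !inE.
  by case: eqP => _; rewrite ?andbF.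
rewrite -!setI_eq0 !setI0 d eqxx.
have -> : X :\ v :|: X :&: [set v] :|: set0 = X.
  by rewrite setU0 setUC setID.
rewrite set0U => /(_ isT isT isT) H.
have {}/H/andP[] : forall x y, x \in X :\ v -> y \in set0 -> ~~ edge x y.
  by move=> x y _; rewrite inE.
have w0 := w_pos (induced X).
have le : lhat ^+ #|X :&: [set v]| <= lhat.
  rewrite -{2}[lhat]expr1 ler_weXn2l ?lhat_ge1 //.
  by rewrite -(cards1 v) subset_leq_card ?subsetIr.
have lh0 : 0 < lhat ^+ #|X :&: [set v]|.
  by rewrite exprn_gt0 // (lt_le_trans ltr01 lhat_ge1).
rewrite ler_pdivlMr // mulrC ler_pdivrMr // ler_pdivrMr // => h1 h2; split.
  apply: (le_trans h1); rewrite mulrC ler_wpM2r //.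
  by rewrite ltW // mulr_gt0.
by apply: (le_trans h2); rewrite ler_wpM2r // ltW.
Qed.
End Weight.

(** * Balanced separators *)

Definition edge_in (G : sgraph) (W : {set G}) : rel G :=
  [rel x y | [&& x \in W, y \in W & edge x y]].

(** Kept as a subset of [G], which avoids subtypes; a vertex outside [W] is alone in its
    component. *)
Definition component (G : sgraph) (W : {set G}) (x : G) : {set G} :=
  [set y | connect (edge_in W) x y].

Lemma connect_homo (S T : finType) (e : rel S) (e' : rel T) (h : S -> T) x y :
  (forall u v, e u v -> e' (h u) (h v)) -> connect e x y -> connect e' (h x) (h y).
Proof.
move=> he /connectP[p]; elim: p x => [|z p IH] x /= => [_ ->|/andP[xz pz] yE].
  exact: connect0.
exact: connect_trans (connect1 (he _ _ xz)) (IH _ pz yE).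
Qed.

Lemma connect_invariant (T : finType) (e : rel T) (Q : T -> Prop) x y :
  (forall u v, Q u -> e u v -> Q v) -> Q x -> connect e x y -> Q y.
Proof.
move=> he + /connectP[p]; elim: p x => [|z p IH] x Qx /= => [_ -> //|/andP[xz pz] yE].
exact: (IH _ (he _ _ Qx xz) pz yE).
Qed.

Section Tree.
Variable (T : sgraph).

(** A simple path from [u] to [t] that avoids the edge between them would close up with it to a
    cycle of at least three vertices. *)
Lemma acyclic_bridge (t u : T) : acyclic T -> edge t u ->
  ~~ connect [rel a b | edge a b && ((a, b) \notin [:: (t, u); (u, t)])] u t.
Proof.
move=> acy tu; apply/negP => /connectP[p pp].
case/shortenP: pp => {}p pp up _ tE.
have pe : path edge u p.
  by apply: sub_path pp => a b /= /andP[].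
have /acy : ucycle edge (u :: p).
  by rewrite /ucycle /cycle rcons_path pe -tE tu.
case: p pp tE {up pe} => [|a [|b p]] //= => [_ tE|/andP[/andP[_ ua] _] tE].
  by rewrite tE edge_irr in tu.
by rewrite tE !inE eqxx orbT in ua.
Qed.

(** The orbit of [t0] becomes periodic. The least period gives a cycle of the graph, hence is at
    most 2, and it is not 1 because there are no loops. *)
Lemma acyclic_2cycle (s : T -> T) (t0 : T) : acyclic T ->
  (forall t, edge t (s t)) -> exists t, s (s t) = t.
Proof.
move=> acy es.
have [i lti E] := trajectP (looping_order s t0).
have ex : exists m, (0 < m)%N && (iter m s (iter i s t0) == iter i s t0).
  exists (order s t0 - i)%N; rewrite subn_gt0 lti /= -iterD subnK ?E //.
  exact: ltnW.
move: (iter i s t0) ex => z ex; case: (ex_minnP ex) => m.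
case: m => [//|m] /andP[_ /eqP zE] minm.
have : ucycle edge (traject s z m.+1).
  apply/andP; split.
    rewrite trajectS /= rcons_path.
    have := es (iter m s z); rewrite -iterS zE last_traject => ->; rewrite andbT.
    by apply: sub_path (fpath_traject s z m) => a b /= /eqP <-.
  (* A repetition inside the cycle would give the smaller period [j.+1]. *)
  rewrite looping_uniq; apply/negP => /trajectP[j ltj mj].
  have : iter (m.+1 - m + j) s z = z.
    by rewrite iterD -mj -iterD subnK // zE.
  rewrite subSnn add1n => jE.
  by have := minm j.+1; rewrite jE eqxx => /(_ isT); rewrite ltnS leqNgt ltj.
move/acy; rewrite size_traject.
case: m zE {minm} => [|[|//]] zE _; last by exists z.
by have := es z; rewrite [s z]zE edge_irr.
Qed.
End Tree.

Section Separator.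
Variables (G T : sgraph) (B : T -> {set G}).
Hypothesis td : tree_decomposition B.

Lemma bags_connected (x : G) (t r r' : T) : x \notin B t -> x \in B r ->
  x \in B r' -> connect (edge_in [set~ t]) r r'.
Proof.
move=> xt xr xr'.
have Hr : r \in [set t | x \in B t] by rewrite inE.
have Hr' : r' \in [set t | x \in B t] by rewrite inE.
have := td_connected td (exist _ r Hr) (exist _ r' Hr').
apply: (connect_homo (h := val)) => u v /= uv.
apply/and3P; split=> //; rewrite !inE; apply/eqP => E.
  by have := valP u; rewrite inE [val u]E (negPf xt).
by have := valP v; rewrite inE [val v]E (negPf xt).
Qed.

(** Adjacent vertices share a bag, and the bags holding a vertex outside [B t] are joined without
    passing through [t]; so all bags meeting the component lie on one side of [t]. *)
Lemma component_bags (W : {set G}) (x y : G) (t r r' : T) :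
  x \in W :\: B t -> y \in component (W :\: B t) x -> x \in B r -> y \in B r' ->
  connect (edge_in [set~ t]) r r'.
Proof.
move=> xW; rewrite inE => xy xr; move: r'.
pose Q z := z \notin B t /\ forall r', z \in B r' -> connect (edge_in [set~ t]) r r'.
suff [] : Q y by [].
apply: (connect_invariant (Q := Q)) xy.
  move=> u v [ut IH] /and3P[_ vW uv].
  have vt : v \notin B t by move: vW; rewrite inE => /andP[].
  split=> // r' vr'; have [q /andP[uq vq]] := td_edge td uv.
  exact: connect_trans (IH _ uq) (bags_connected vt vq vr').
have xt : x \notin B t by move: xW; rewrite inE => /andP[].
by split=> // r' xr'; apply: bags_connected xt xr xr'.
Qed.

(** The neighbour [u] is the first step of a simple path from [t] to a bag of [x]; the rest of that
    path avoids [t]. *)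
Lemma component_direction (W : {set G}) (x : G) (t : T) : x \in W :\: B t ->
  exists2 u, edge t u & forall y r, y \in component (W :\: B t) x -> y \in B r ->
    connect (edge_in [set~ t]) u r.
Proof.
move=> xW; have [r xr] := td_vertex td x.
have [_ conn _] := td_tree td.
have /connectP[p pp] := conn t r.
case/shortenP: pp => -[|u q] pq uq _ /= rE.
  by move: xW; rewrite inE -rE xr.
move: pq => /= /andP[tu pq]; exists u => // y r' yC yr'.
apply: connect_trans (component_bags xW yC xr yr'); apply/connectP; exists q => //.
have: t \notin u :: q by case/andP: uq.
elim: q u {uq tu rE} pq => //= v q IH u /andP[uv pv].
rewrite !inE !negb_or => /and3P[tu tv tq].
rewrite IH ?inE ?negb_or ?tv // andbT; apply/and3P.
by split=> //; rewrite !inE eq_sym.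
Qed.

Lemma component_sub (W : {set G}) (x : G) : x \in W -> component W x \subset W.
Proof.
move=> xW; apply/subsetP => y; rewrite inE.
by apply: (connect_invariant (Q := fun y => y \in W)) => // u v _ /and3P[].
Qed.

(* If every bag left a component with more than half of W, then each tree node
   would point to the neighbour on the side of that component.  Following the
   pointers in a finite tree one traverses some edge in both directions, but
   the two big components then meet in a vertex whose bags lie on both sides. *)
Lemma balanced_separator (W : {set G}) : exists t, forall x,
  x \in W :\: B t -> (#|component (W :\: B t) x| * 2 <= #|W|)%N.
Proof.
apply: contrapT => no.
have big t : exists x, x \in W :\: B t /\
    (#|W| < #|component (W :\: B t) x| * 2)%N.
  apply: contrapT => H; apply: no; exists t => x xW; rewrite leqNgt.
  by apply/negP => lt; apply: H; exists x.
have [x xP] := fin_all_exists big.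
have dir t : exists u, edge t u /\ forall y r,
    y \in component (W :\: B t) (x t) -> y \in B r -> connect (edge_in [set~ t]) u r.
  by have [u] := component_direction (xP t).1; exists u.
have [s sP] := fin_all_exists dir.
have [T0 _ acy] := td_tree td.
have /card_gt0P[t0 _] := T0.
have [t stt] := acyclic_2cycle t0 acy (fun t => (sP t).1).
have [y] : exists y, y \in component (W :\: B t) (x t) :&:
                         component (W :\: B (s t)) (x (s t)).
  apply/set0Pn; apply/negP => /eqP C0.
  have [x1 lt1] := xP t; have [x2 lt2] := xP (s t).
  have := cardsUI (component (W :\: B t) (x t)) (component (W :\: B (s t)) (x (s t))).
  rewrite C0 cards0 addn0 => cU.
  have : (#|component (W :\: B t) (x t) :|: component (W :\: B (s t)) (x (s t))| <= #|W|)%N.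
    apply: subset_leq_card; rewrite subUset.
    by rewrite !(subset_trans (component_sub _)) ?subsetDl.
  rewrite cU -(leq_pmul2r (ltn0Sn 1)) mulnDl leqNgt muln2 -addnn.
  by rewrite -addSn leq_add // ltnW.
rewrite inE => /andP[y1 y2]; have [r yr] := td_vertex td y.
have [e1 /(_ y r y1 yr) c1] := sP t.
have [e2 /(_ y r y2 yr) c2] := sP (s t).
rewrite stt in c2 e2.
(* A walk avoiding [t] or [s t] never uses the edge between them, so the two walks to [r] together
   connect its ends without it. *)
have /negP := acyclic_bridge acy e1; apply.
set e := [rel a b | _].
have e_sym : connect_sym e.
  apply: sym_connect_sym => a b /=; rewrite edge_sym; congr (_ && ~~ _).
  by rewrite !inE !xpair_eqE orbC andbC (andbC (a == t)).
apply: (@connect_trans _ _ r).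
  apply: (connect_homo (h := fun z => z)) c1 => a b /= /and3P[].
  rewrite !inE !xpair_eqE => /negPf -> /negPf -> ->.
  by rewrite andbF.
rewrite e_sym; apply: (connect_homo (h := fun z => z)) c2 => a b /= /and3P[].
rewrite !inE !xpair_eqE => /negPf -> /negPf -> ->.
by rewrite andbF.
Qed.

End Separator.

(** * The Poincare constant of a graph *)

Section GraphPoincare.
Variables (R : realType) (w : sgraph -> R) (lambda : R).
Hypotheses (w_inv : graph_function w) (w_pos : positive_graph_function w)
           (w_mul : vertex_multiplicative lambda w) (lambda_gt0 : 0 < lambda).
Let lhat := Num.max lambda lambda^-1.
Variable G : sgraph.
Let om (X : {set G}) := w (induced X).
Let om_gt0 X : 0 < om X := w_pos _.
Let lhat_ge1 : 1 <= lhat := lhat_ge1 lambda_gt0.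
Let lhat_ge0 : 0 <= lhat := le_trans ler01 lhat_ge1.

(** Comparison with the product weight [om'] holds within a factor [lhat], which perturbation
    squares; the product then tensorizes. The lower bound on [A] covers the constant of the single
    vertex [v]. *)
Lemma poincare_setU1 (U : {set G}) (v : G) (A : R) : 2^-1 <= A ->
  poincare U om A -> poincare (v |: U) om (lhat ^+ 2 * A).
Proof.
move=> A2 H; have A0 : 0 <= A by apply: le_trans A2; rewrite invr_ge0.
have [vU|vU] := boolP (v \in U).
  rewrite (setUidPr _) ?sub1set //; apply: poincare_le H => //.
  by rewrite ler_peMl // exprn_ege1.
pose om' (X : {set G}) := om (X :\ v) * om (X :&: [set v]).
apply: (poincare_perturb (om' := om')) => //.
- by move=> X; rewrite mulr_gt0.
- by move=> X _; have [] := induced_setD1 w_inv w_pos w_mul lambda_gt0 X v.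
- by move=> X _; have [] := induced_setD1 w_inv w_pos w_mul lambda_gt0 X v.
apply: (poincare_prod (om1 := om) (om2 := om)) => //.
- by rewrite disjoints1.
- move=> X1 X2; rewrite subset1 => X1v X2U.
  have vX2 : v \notin X2 by apply: contra vU; apply: subsetP.
  rewrite /om' setDUl setIUl mulrC; congr (om _ * om _).
    rewrite (_ : X2 :&: [set v] = set0) ?setU0.
      by case/orP: X1v => /eqP ->; rewrite ?set0I // setIid.
    by apply/eqP; rewrite setI_eq0 disjoint_sym disjoints1.
  rewrite (_ : X1 :\ v = set0) ?set0U.
    by apply/setP => x; rewrite !inE; case: eqP => // ->; rewrite (negPf vX2).
  by case/orP: X1v => /eqP ->; rewrite ?set0D // setDv.
- by apply: poincare_le (poincare1 _ _).
Qed.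

Lemma poincare_setU_card n (S U : {set G}) (A : R) : 2^-1 <= A ->
  poincare U om A -> #|S| = n -> poincare (S :|: U) om (lhat ^+ (2 * n) * A).
Proof.
move=> A2 H; elim: n S => [|n IH] S => [/cards0_eq ->|Sn].
  by rewrite set0U muln0 expr0 mul1r.
have /card_gt0P[v vS] : (0 < #|S|)%N by rewrite Sn.
rewrite -(setD1K vS) -setUA mulnS exprD -mulrA; apply: poincare_setU1.
  apply: (le_trans A2); rewrite ler_peMl ?exprn_ege1 //.
  by apply: le_trans A2; rewrite invr_ge0.
by apply: IH; have := cardsD1 v S; rewrite vS Sn => -[].
Qed.

(** No edge inside [W] joins distinct components, so [w] is a product over them and the constant
    tensorizes. *)
Lemma poincare_component (W : {set G}) (A : R) : 0 <= A ->
  (forall x, x \in W -> poincare (component W x) om A) -> poincare W om A.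
Proof.
move=> A0 H.
(* Induction over unions [Q] of components, described as subsets closed under the edges inside [W];
   one component is split off at a time. *)
suff : forall n (Q : {set G}), (#|Q| <= n)%N -> Q \subset W ->
    (forall x y, x \in Q -> edge_in W x y -> y \in Q) -> poincare Q om A.
  move=> /(_ #|W| W (leqnn _) (subxx _)); apply.
  by move=> x y _ /and3P[].
elim=> [|n IH] Q; first by rewrite leqn0 => /eqP/cards0_eq -> _ _; apply: poincare0.
have [->|/set0Pn[x xQ]] := eqVneq Q set0; first by move=> *; apply: poincare0.
move=> Qn QW clQ; set C := component W x.
have csym : connect_sym (edge_in W).
  by apply: sym_connect_sym => a b /=; rewrite /edge_in /= edge_sym andbCA.
have CQ : C \subset Q.
  apply/subsetP => y; rewrite inE; apply: (connect_invariant (Q := fun y => y \in Q)) => //.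
have xC : x \in C by rewrite inE connect0.
have dis : [disjoint C & Q :\: C] by rewrite -setI_eq0 setIDA setIC -setIDA setDv setI0.
rewrite -(setID Q C) (setIidPr CQ).
apply: (poincare_prod (om1 := om) (om2 := om)) => //.
- move=> X1 X2 X1C X2Q; apply: (induced_disjoint w_inv w_pos w_mul).
    exact: (disjointWl X1C (disjointWr X2Q dis)).
  move=> a b /(subsetP X1C) aC /(subsetP X2Q); rewrite inE => /andP[bC bQ].
  apply/negP => ab; move/negP: bC; apply.
  move: (aC); rewrite !inE => /connect_trans; apply; apply: connect1.
  by rewrite /edge_in /= ab (subsetP QW _ bQ) (subsetP QW _ (subsetP CQ _ aC)).
- by apply: H; apply: (subsetP QW).
apply: IH.
- rewrite -ltnS (leq_trans _ Qn) // proper_card //; apply/properP; split.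
    exact: subsetDl.
  by exists x => //; rewrite inE xC.
- exact: subset_trans (subsetDl _ _) QW.
move=> a b; rewrite !inE => /andP[aC aQ] ab; rewrite (clQ _ _ aQ ab) andbT.
apply: contra aC => /connect_trans; apply; rewrite csym.
exact: connect1.
Qed.

(** Each round removes one bag, at a cost of at most [lhat ^+ (2 * k)], and leaves components of at
    most half the size. Since the bound by [2 ^ m] is strict, [m = 0] leaves only the empty set. *)
Lemma poincare_treewidth (T : sgraph) (B : T -> {set G}) (k m : nat) (U : {set G}) :
  tree_decomposition B -> (forall t, (#|B t| <= k)%N) -> (#|U| < 2 ^ m)%N ->
  poincare U om (lhat ^+ (2 * k * m) / 2).
Proof.
move=> td Bk; have half j : 2^-1 <= lhat ^+ j / 2.
  by rewrite ler_peMl ?invr_ge0 // exprn_ege1.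
elim: m U => [|m IH] U Um.
  move: Um; rewrite expn0 ltnS leqn0 => /eqP/cards0_eq ->; exact: poincare0.
have [t tP] := balanced_separator td U.
rewrite -(setID U (B t)) mulnS exprD -mulrA.
have HU : poincare (U :\: B t) om (lhat ^+ (2 * k * m) / 2).
  apply: poincare_component => [|x xU].
    by apply: le_trans (half _); rewrite invr_ge0.
  apply: IH; rewrite -(ltn_pmul2r (ltn0Sn 1)) -expnSr.
  exact: leq_ltn_trans (tP x xU) Um.
apply: poincare_le (poincare_setU_card (half _) HU (erefl #|U :&: B t|)) => //.
rewrite ler_wpM2r ?(le_trans _ (half _)) ?invr_ge0 //.
rewrite ler_weXn2l // leq_mul2l /=.
by rewrite (leq_trans (subset_leq_card (subsetIr _ _)) (Bk t)).
Qed.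

End GraphPoincare.

(** * Mixing of the flip chain *)

Section Chain.
Variables (R : realType) (w : sgraph -> R).
Hypothesis w_pos : positive_graph_function w.
Variable G : sgraph.
Hypothesis G_gt0 : (0 < #|G|)%N.
Let om (X : {set G}) := w (induced X).
Let om_gt0 X : 0 < om X := w_pos _.
Let P := @flip_chain R w G.
Let pi := @flip_stationary R w G.
Let n : R := #|G|%:R.
Let n_gt0 : 0 < n. Proof. by rewrite ltr0n. Qed.
Let Z : R := \sum_(X : {set G}) om X.
Let Z_gt0 : 0 < Z. Proof. exact: (sum_gt0 (i := finset.set0)). Qed.

Lemma flip_acceptE (X S : {set G}) :
  om X * flip_accept w X S = 2^-1 * Num.min (om X) (om S).
Proof.
rewrite /flip_accept mulrCA; congr (_ * _).
by rewrite minr_pMr ?ltW // mulr1 [om X * _]mulrC divfK ?gt_eqF.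
Qed.

Lemma flip_accept_ge0 (X S : {set G}) : 0 <= flip_accept w X S.
Proof. by rewrite mulr_ge0 ?invr_ge0 // le_min ler01 divr_ge0 ?ltW. Qed.

Lemma flip_accept_le (X S : {set G}) : flip_accept w X S <= 2^-1.
Proof. by rewrite ler_piMr ?invr_ge0 // ge_min lexx. Qed.

Lemma flip_chain_apply (g : {set G} -> R) (X : {set G}) :
  \sum_Y P X Y * g Y =
  n^-1 * \sum_v (g X + flip_accept w X (flip X v) * (g (flip X v) - g X)).
Proof.
rewrite /P /flip_chain; under eq_bigr do rewrite mulr_suml.
rewrite exchange_big mulr_sumr /=; apply: eq_bigr => v _.
under eq_bigr do rewrite -mulrA.
rewrite -mulr_sumr; congr (_ * _).
move: (flip_accept w X (flip X v)) => a.
under eq_bigr do rewrite mulrDl -!mulrA.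
rewrite big_split /= -!mulr_sumr.
have pick S : \sum_Y (Y == S)%:R * g Y = g S.
  rewrite (bigD1 S) //= eqxx mul1r big1 ?addr0 // => Y /negPf ->.
  by rewrite mul0r.
by rewrite !pick; ring.
Qed.

Lemma flip_chain_sum1 (X : {set G}) : \sum_Y P X Y = 1.
Proof.
have := flip_chain_apply (fun=> 1) X.
under eq_bigr do rewrite mulr1.
move=> ->; under eq_bigr do rewrite subrr mulr0 addr0.
by rewrite sumr_const mulVf ?gt_eqF.
Qed.

Lemma flip_chain_reversible (X Y : {set G}) : om X * P X Y = om Y * P Y X.
Proof.
rewrite /P /flip_chain !mulr_sumr; apply: eq_bigr => v _.
rewrite !(mulrCA _ #|G|%:R^-1); congr (_ * _).
rewrite !mulrDr; congr (_ + _).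
  rewrite (_ : (Y == flip X v) = (X == flip Y v)); last first.
    by apply/eqP/eqP => ->; rewrite flipK.
  have [->|_] := eqVneq X (flip Y v); last by rewrite !mulr0.
  by rewrite flipK !mulr1 !flip_acceptE minC.
by rewrite eq_sym; have [->|_] := eqVneq X Y; rewrite ?mulr0.
Qed.

(* Each two-point kernel is at least 1/2-lazy, so that the square of its norm
   is dominated by its quadratic form. *)
Lemma flip_step_contract (g : {set G} -> R) (v : G) :
  \sum_X om X * (g X + flip_accept w X (flip X v) * (g (flip X v) - g X)) ^+ 2
  <= \sum_X om X * g X ^+ 2 -
     4^-1 * \sum_X Num.min (om X) (om (flip X v)) * (g (flip X v) - g X) ^+ 2.
Proof.
pose c X := 2^-1 * Num.min (om X) (om (flip X v)).
pose d X := g (flip X v) - g X.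
(* Reindexing by the involution [flip], which fixes [c] and negates [d], turns the cross term into a
   square. *)
have S : \sum_X c X * (2 * g X * d X) = - \sum_X c X * d X ^+ 2.
  have -> : \sum_X c X * (2 * g X * d X) =
      \sum_X c X * (g X * d X) + \sum_X c X * (g X * d X).
    by rewrite -big_split /=; apply: eq_bigr => X _; ring.
  rewrite {1}(reindex_inj (inv_inj (@flipK G v))) /=.
  rewrite -big_split -sumrN /=; apply: eq_bigr => X _.
  by rewrite /c /d flipK minC; ring.
have -> : \sum_X om X * g X ^+ 2 -
     4^-1 * \sum_X Num.min (om X) (om (flip X v)) * (g (flip X v) - g X) ^+ 2 =
   \sum_X (om X * g X ^+ 2 + c X * (2 * g X * d X) + 2^-1 * (c X * d X ^+ 2)).
  rewrite !big_split /= S -addrA; congr (_ + _).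
  rewrite mulr_sumr -!sumrN -big_split /=; apply: eq_bigr => X _.
  by rewrite /c /d; field.
apply: ler_sum => X _; rewrite -/(d X); set a := flip_accept _ _ _.
have cE : c X = om X * a by rewrite flip_acceptE.
have -> : om X * (g X + a * d X) ^+ 2 =
    om X * g X ^+ 2 + c X * (2 * g X * d X) + a * (c X * d X ^+ 2).
  by rewrite cE; ring.
rewrite lerD2l ler_wpM2r ?flip_accept_le //.
by rewrite mulr_ge0 ?sqr_ge0 // cE mulr_ge0 ?flip_accept_ge0 ?ltW.
Qed.

(** Jensen moves the square inside the average over [v]; the estimates for single vertices then add
    up to the Dirichlet form. *)
Lemma flip_chain_contract (g : {set G} -> R) :
  \sum_X om X * (\sum_Y P X Y * g Y) ^+ 2 <=
  \sum_X om X * g X ^+ 2 - (4 * n)^-1 * dirichlet [set: G] om g.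
Proof.
pose y X v := g X + flip_accept w X (flip X v) * (g (flip X v) - g X).
have jensen X : (\sum_Y P X Y * g Y) ^+ 2 <= n^-1 * \sum_v y X v ^+ 2.
  have sn : \sum_(v : G) (1 : R) = n by rewrite sumr_const.
  rewrite ler_pdivlMl // -sn.
  rewrite [leRHS](eq_bigr (fun v => 1 * y X v ^+ 2)) => [|v _]; last by rewrite mul1r.
  apply: weighted_jensen => //.
  rewrite sn flip_chain_apply mulVKf ?gt_eqF //.
  by apply: eq_bigr => v _; rewrite mul1r.
apply: (@le_trans _ _ (n^-1 * \sum_v \sum_X om X * y X v ^+ 2)).
  rewrite exchange_big mulr_sumr /=; apply: ler_sum => X _.
  by rewrite -mulr_sumr [leRHS]mulrCA ler_wpM2l ?jensen ?(ltW (om_gt0 _)).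
apply: (@le_trans _ _ (n^-1 * \sum_(v : G) (\sum_X om X * g X ^+ 2 -
     4^-1 * \sum_X Num.min (om X) (om (flip X v)) * (g (flip X v) - g X) ^+ 2))).
  rewrite ler_wpM2l ?invr_ge0 ?(ltW n_gt0) //; apply: ler_sum => v _.
  exact: flip_step_contract.
rewrite sumrB mulrBr sumr_const -[_ *+ _]mulr_natl -/n mulKf ?gt_eqF //.
rewrite lerD2l lerN2 -mulr_sumr invfM mulrA (mulrC n^-1) le_eqVlt; apply/orP; left.
apply/eqP; congr (_ * _); rewrite /dirichlet.
apply: eq_big => [v|v _]; first by rewrite in_setT.
by apply: eq_bigl => X; rewrite subsetT.
Qed.

Variable A : R.
Hypotheses (A_gt0 : 0 < A) (PI : poincare [set: G] om A).

(** For [g] of mean zero the Poincare inequality bounds the loss from below by a multiple of the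
    norm; then [1 - x <= exp (- x)] applies. *)
Lemma flip_chain_decay (g : {set G} -> R) : \sum_X om X * g X = 0 ->
  \sum_X om X * (\sum_Y P X Y * g Y) ^+ 2 <=
  expR (- (4 * n * A)^-1) * \sum_X om X * g X ^+ 2.
Proof.
move=> g0; apply: le_trans (flip_chain_contract g) _.
set D := dirichlet _ _ _; set N := \sum_X _.
have N0 : 0 <= N by apply: sumr_ge0 => X _; rewrite mulr_ge0 ?sqr_ge0 ?ltW.
have sT (F : {set G} -> R) : \sum_(X : {set G} | X \subset [set: G]) F X = \sum_X F X.
  by apply: eq_bigl => X; rewrite subsetT.
have ND : N <= A * D.
  have := @poincare_mean _ _ _ _ _ g 0 om_gt0 PI.
  rewrite !sT g0 mulr0 => /(_ erefl); congr (_ <= _).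
  by apply: eq_bigr => X _; rewrite subr0.
apply: (@le_trans _ _ ((1 - (4 * n * A)^-1) * N)).
  rewrite mulrBl mul1r lerD2l lerN2 invfM -mulrA.
  rewrite ler_wpM2l ?invr_ge0 ?mulr_ge0 ?(ltW n_gt0) //.
  by rewrite ler_pdivrMl.
by rewrite ler_wpM2r // (le_trans _ (expR_ge1Dx _)) // lerD2l.
Qed.

(** Density of the law at time [t] relative to [pi], minus 1; its squared norm is [Z] times the
    chi-square distance. *)
Let h X0 t X := iter_kernel P t X0 X / pi X - 1.

Lemma iter_flip_chain_decay (X0 : {set G}) (t : nat) :
  \sum_X om X * h X0 t X = 0 /\
  \sum_X om X * h X0 t X ^+ 2 <= expR (- (t%:R / (4 * n * A))) * (Z ^+ 2 / om X0).
Proof.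
have piE X : pi X = om X / Z by [].
have pi_gt0 X : 0 < pi X by rewrite piE divr_gt0.
elim: t => [|t [IH0 IH]]; rewrite {1 2}/h /=.
  have sE (F : {set G} -> R) : \sum_X om X * ((X0 == X)%:R * F X) = om X0 * F X0.
    rewrite (bigD1 X0) //= eqxx mul1r big1 ?addr0 // => X.
    by rewrite eq_sym => /negPf ->; rewrite mul0r mulr0.
  split.
    under eq_bigr do rewrite mulrBr mulr1.
    by rewrite sumrB sE piE -/Z; field; rewrite !gt_eqF.
  (* At time 0 the sum equals [Z ^+ 2 / om X0 - Z]. *)
  rewrite (eq_bigr (fun X => om X * ((X0 == X)%:R * ((pi X)^-1 ^+ 2 - 2 / pi X))
      + om X)) => [|X _]; last by case: (X0 == X) => /=; ring.
  rewrite big_split /= sE -/Z piE mul0r oppr0 expR0 mul1r -subr_ge0.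
  have -> : Z ^+ 2 / om X0 -
     (om X0 * ((om X0 / Z)^-1 ^+ 2 - 2 / (om X0 / Z)) + Z) = Z.
    by field; rewrite !gt_eqF.
  exact: ltW.
(* By reversibility the density evolves under [P] acting on functions. *)
have hS X : (\sum_Y iter_kernel P t X0 Y * P Y X) / pi X - 1 =
    \sum_Y P X Y * h X0 t Y.
  rewrite -(flip_chain_sum1 X) mulr_suml -sumrB; apply: eq_bigr => Y _.
  have : pi X * P X Y = pi Y * P Y X.
    by rewrite !piE !(mulrAC _ Z^-1) flip_chain_reversible.
  rewrite mulrC => /(canRL (mulfK (lt0r_neq0 (pi_gt0 X)))) ->.
  by rewrite /h; field; rewrite !gt_eqF.
under eq_bigr do rewrite hS.
under [X in _ /\ X <= _]eq_bigr do rewrite hS.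
split.
  under eq_bigr do rewrite mulr_sumr.
  rewrite exchange_big /= -[RHS]IH0; apply: eq_bigr => Y _.
  under eq_bigr do rewrite mulrA flip_chain_reversible.
  by rewrite -mulr_suml -mulr_sumr flip_chain_sum1 mulr1.
apply: le_trans (flip_chain_decay IH0) _.
rewrite -[t.+1%:R]natr1 [(_ + 1) / _]mulrDl mul1r opprD expRD [expR _ * expR _]mulrC -[leRHS]mulrA.
by rewrite ler_wpM2l ?expR_ge0.
Qed.

(** By Jensen, twice the total variation distance is at most the root of the chi-square distance,
    which the assumption on [t] brings down to [eps]. *)
Lemma tv_dist_iter_flip_chain (X0 : {set G}) (eps : R) (t : nat) : 0 < eps ->
  ln (Z / om X0) + 2 * ln eps^-1 <= t%:R / (4 * n * A) ->
  tv_dist (iter_kernel P t X0) pi <= eps.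
Proof.
move=> eps0 tP; have [_ dec] := iter_flip_chain_decay X0 t.
have pi_gt0 X : 0 < pi X by rewrite divr_gt0.
have sum_pi : \sum_X pi X = 1 by rewrite -mulr_suml mulfV ?gt_eqF.
have -> : tv_dist (iter_kernel P t X0) pi = 2^-1 * \sum_X pi X * `|h X0 t X|.
  congr (_ * _); apply: eq_bigr => X _.
  rewrite -{2}[pi X]gtr0_norm // -normrM; congr `|_|.
  by rewrite /h; field; rewrite gt_eqF.
set S := \sum_X _; have S0 : 0 <= S.
  by apply: sumr_ge0 => X _; rewrite mulr_ge0 ?normr_ge0 ?(ltW (pi_gt0 X)).
have : S ^+ 2 <= \sum_X pi X * `|h X0 t X| ^+ 2.
  rewrite -[leLHS]mul1r -sum_pi; apply: weighted_jensen => [X _|].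
    exact: ltW.
  by rewrite sum_pi mul1r.
have -> : \sum_X pi X * `|h X0 t X| ^+ 2 = (\sum_X om X * h X0 t X ^+ 2) / Z.
  by rewrite mulr_suml; apply: eq_bigr => X _; rewrite real_normK ?num_real // mulrAC.
have bound : expR (- (t%:R / (4 * n * A))) * (Z ^+ 2 / om X0) / Z <= eps ^+ 2.
  have -> : expR (- (t%:R / (4 * n * A))) * (Z ^+ 2 / om X0) / Z =
      expR (- (t%:R / (4 * n * A)) + ln (Z / om X0)).
    rewrite expRD lnK ?posrE ?divr_gt0 //.
    by field; rewrite !gt_eqF.
  rewrite -[eps in leRHS]lnK ?posrE // -expRM_natl ler_expR.
  by move: tP; rewrite lnV ?posrE //; lra.
move=> S2; have {}S2 : S ^+ 2 <= eps ^+ 2.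
  apply: le_trans bound; apply: (le_trans S2).
  by rewrite ler_wpM2r // invr_ge0 ltW.
have : S <= eps by rewrite -(ler_pXn2r (n := 2)) ?nnegrE // ltW.
by move: S0 eps0; lra.
Qed.
End Chain.

(** * Exponential bounds on the weights *)

Section Weights.
Variables (R : realType) (w : sgraph -> R) (lambda : R).
Hypotheses (w_inv : graph_function w) (w_pos : positive_graph_function w)
           (w_mul : vertex_multiplicative lambda w) (lambda_gt0 : 0 < lambda).
Let lhat := Num.max lambda lambda^-1.

(** Adding a vertex changes the weight by a factor between [w1 / lhat] and [lhat * w1], where [w1]
    is the weight of the one-vertex graph. One [M] serves all graphs, so it may enter the implied
    constant. *)
Lemma induced_weight_bound : exists2 M : R, 1 <= M &
  forall (G : sgraph) (X : {set G}), M ^- #|G| <= w (induced X) <= M ^+ #|G|.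
Proof.
have sym1 : symmetric (fun _ _ : unit => false) by [].
have irr1 : irreflexive (fun _ _ : unit => false) by [].
pose w1 := w (SGraph sym1 irr1); have w1_gt0 : 0 < w1 := w_pos _.
have w1E (G : sgraph) (v : G) : w (induced [set v]) = w1.
  apply: w_inv; exists (fun=> tt); split.
    apply: inj_card_bij => [[x xv] [y yv] _|]; last by rewrite card_sig cards1 card_unit.
    by apply: val_inj => /=; move: xv yv; rewrite !inE => /eqP -> /eqP ->.
  move=> [x xv] [y yv]; have /set1P xE := xv; have /set1P yE := yv.
  by rewrite /= /induced_edge /= xE yE edge_irr.
(* The empty set is the disjoint union of itself with itself, so its weight equals its own
   square. *)
have w0E (G : sgraph) : w (induced (finset.set0 : {set G})) = 1.
  have := @induced_disjoint _ _ _ w_inv w_pos w_mul G finset.set0 finset.set0.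
  rewrite setU0 -setI_eq0 setI0 eqxx => /(_ isT) H.
  apply: (mulfI (lt0r_neq0 (w_pos (induced (finset.set0 : {set G}))))).
  by rewrite mulr1 -H // => x y; rewrite inE.
have lh1 : 1 <= lhat := lhat_ge1 lambda_gt0.
have lh0 : 0 < lhat by apply: lt_le_trans lh1.
(* Large enough to dominate 1, [lhat * w1] and [lhat / w1]. *)
pose M := lhat * (1 + w1 + w1^-1).
have w1i_gt0 : 0 < w1^-1 by rewrite invr_gt0.
have M1 : 1 <= M by rewrite /M; nra.
have M0 : 0 < M by apply: lt_le_trans M1.
exists M => // G X.
suff H : forall m (X : {set G}), #|X| = m -> M ^- m <= w (induced X) <= M ^+ m.
  have /andP[h1 h2] := H _ X erefl.
  have le : M ^+ #|X| <= M ^+ #|G| by rewrite ler_weXn2l // max_card.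
  rewrite (le_trans _ h1) ?(le_trans h2) //.
  by rewrite lef_pV2 ?posrE ?exprn_gt0.
elim=> [|m IH] {}X => [/cards0_eq ->|Xm].
  by rewrite expr0 invr1 w0E lexx.
have /card_gt0P[v vX] : (0 < #|X|)%N by rewrite Xm.
have [] := induced_setD1 w_inv w_pos w_mul lambda_gt0 X v.
have -> : X :&: [set v] = [set v] by apply/setIidPr; rewrite sub1set.
have /IH /andP[] : #|X :\ v| = m by have := cardsD1 v X; rewrite vX Xm => -[].
rewrite w1E -/lhat; set a := w (induced X); set b := w (induced _).
move=> h1 h2 h3 h4; apply/andP; split; last first.
  apply: (le_trans h3); rewrite exprSr mulrCA ler_pM //.
  - exact: (ltW (w_pos _)).
  - exact: ltW (mulr_gt0 lh0 w1_gt0).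
  - by rewrite /M ler_wpM2l ?(ltW lh0) //; lra.
rewrite exprSr invfM; apply: (@le_trans _ _ (b * (w1 / lhat))).
  rewrite ler_pM ?invr_ge0 ?exprn_ge0 ?(ltW M0) //.
  rewrite -(invf_div lhat w1) lef_pV2 ?posrE ?divr_gt0 //.
  by rewrite /M ler_wpM2l ?(ltW lh0) //; lra.
by rewrite mulrA ler_pdivrMr // [a * _]mulrC.
Qed.

End Weights.

(** * Assembling the mixing time bound *)

Lemma expR_norm_ln (R : realType) (lambda : R) : 0 < lambda ->
  expR `|ln lambda| = Num.max lambda lambda^-1.
Proof.
move=> l0; have [l1|/ltW l1] := leP 1 lambda.
  rewrite ger0_norm ?ln_ge0 // lnK ?posrE // max_l //.
  by rewrite (le_trans _ l1) // invf_le1.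
rewrite ler0_norm ?ln_le0 // expRN lnK ?posrE // max_r //.
by rewrite (le_trans l1) // invf_ge1.
Qed.

(** The maximum is 2 to the power [|log2 lambda|], and 2 to the power [trunc_log 2 n] is at most
    [n]. *)
Lemma expn_trunc_log_le (R : realType) (lambda : R) (n j : nat) : 0 < lambda ->
  (0 < n)%N ->
  Num.max lambda lambda^-1 ^+ (j * trunc_log 2 n)
    <= n%:R `^ (j%:R * `|log2 lambda|).
Proof.
move=> l0 n0; have n0' : 0 < n%:R :> R by rewrite ltr0n.
have ln2 : 0 < ln 2 :> R by rewrite ln_gt0 // ltr1n.
rewrite -expR_norm_ln // -expRM_natl /powR gt_eqF // ler_expR.
have le : (trunc_log 2 n)%:R * ln 2 <= ln n%:R :> R.
  rewrite mulr_natl -lnXn // ler_ln ?posrE ?exprn_gt0 // -natrX ler_nat.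
  exact: trunc_logP.
rewrite /log2 normrM normfV (gtr0_norm ln2) natrM -mulrA -[leRHS]mulrA.
rewrite ler_wpM2l // mulrC -[leRHS]mulrA ler_wpM2l //.
by rewrite ler_pdivlMl // mulrC.
Qed.

Theorem theorem6 (R : realType) (w : sgraph -> R) (lambda : R)
    (w_inv : graph_function w) (w_pos : positive_graph_function w) (lambda_gt0 : 0 < lambda)
    (w_mul : vertex_multiplicative lambda w) (k : nat) :
  exists C : R, forall (G : sgraph) (eps : R),
    treewidth G = k -> 0 < eps -> eps <= 2^-1 ->
    (flip_mixing_time w G eps <=
     (C * #|G|%:R `^ (2 + 4 * (k.+1)%:R * `|log2 lambda|) * ln eps^-1)%:E)%E.
Proof.
have [M M1 wM] := induced_weight_bound w_inv w_pos w_mul lambda_gt0.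
have M0 : 0 < M by apply: lt_le_trans M1.
set lhat := Num.max lambda lambda^-1.
have lh1 : 1 <= lhat := lhat_ge1 lambda_gt0.
pose Q := lhat ^+ (2 * k.+1); have Q1 : 1 <= Q by rewrite exprn_ege1.
(* Bounds [ln (1 / pi X0)] per vertex: there are [2 ^ n] states, with weights between [M ^- n] and
   [M ^+ n]. *)
pose L := ln (2 * M ^+ 2).
have L0 : 0 <= L.
  by rewrite ln_ge0 //; move: M1; nra.
(* The first term covers the real time [r] below; the summand 2 covers rounding it up to an
   integer. *)
exists (4 * Q * (L + 1) + 2) => G eps twG eps0 eps1.
(* From [1 + ln eps <= eps <= 1/2]. *)
have ell : 2^-1 <= ln eps^-1.
  have := expR_ge1Dx (ln eps); rewrite lnK ?posrE // lnV ?posrE //.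
  by move: eps1; lra.
set e := 2 + _; set bound := _ * _ * _.
have bound0 : 0 <= bound.
  rewrite /bound !mulr_ge0 ?powR_ge0 //; last by move: ell; lra.
  by rewrite addr_ge0 // !mulr_ge0 ?addr_ge0 //; move: Q1; lra.
apply: bigmax_le => [|X0 _]; first exact: leNye.
suff [t [tv tb]] : exists t : nat,
    tv_dist (iter_kernel (@flip_chain R w G) t X0) (@flip_stationary R w G) <= eps
    /\ t%:R <= bound.
  by apply: ge_ereal_inf; exists t%:R%:E => //; exists t.
(* Without vertices there is a single state, and the law at time 0 is already stationary. *)
have [G0|G0] := posnP #|G|.
  exists 0%N; split=> //.
  have X0E (X : {set G}) : X = X0.
    by apply/setP => x; have := fintype0 x G0.
  rewrite /tv_dist big1 ?mulr0 ?ltW // => X _ /=.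
  rewrite (X0E X) eqxx /flip_stationary (bigD1 X0) //= big1 => [|Y].
    by rewrite addr0 divff ?subrr ?normr0 // gt_eqF.
  by rewrite (X0E Y) eqxx.
have n1 : 1 <= #|G|%:R :> R by rewrite ler1n.
(* The number of vertices must lie strictly below [2 ^ m], hence the successor. *)
pose m := (trunc_log 2 #|G|).+1.
pose A := lhat ^+ (2 * k.+1 * m) / 2.
have A0 : 0 < A by rewrite divr_gt0 // exprn_gt0 // (lt_le_trans ltr01).
have PI : poincare [set: G] (fun X => w (induced X)) A.
  have [T [B [td wd]]] : has_td_of_width G k.
    by move: twG; rewrite /treewidth; case: ex_minnP => k' /asboolP + _ <-.
  apply: (poincare_treewidth w_inv w_pos w_mul lambda_gt0 td).
    by move=> t; rewrite -wd (leq_trans _ (leqSpred _)) // (leq_bigmax t).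
  by rewrite cardsT trunc_log_ltn.
pose P : R := #|G|%:R `^ (4 * k.+1%:R * `|log2 lambda|).
have P1 : 1 <= P.
  by rewrite /P -[leLHS](powRr0 #|G|%:R) ler_powR // !mulr_ge0.
(* Of the [m] rounds, one is absorbed in the constant [Q]; the others give at most a power of the
   number of vertices with half the exponent of [P]. *)
have AP : A <= Q * P / 2.
  rewrite /A ler_wpM2r ?invr_ge0 // [(2 * k.+1 * m)%N]mulnS exprD ler_wpM2l ?(le_trans ler01 Q1) //.
  apply: le_trans (expn_trunc_log_le _ lambda_gt0 G0) _.
  by rewrite ler_powR // ler_wpM2r // -natrM ler_nat leq_mul2r.
pose Z := \sum_(X : {set G}) w (induced X).
have Z0 : 0 < Z by apply: (sum_gt0 (i := finset.set0)).
pose D := ln (Z / w (induced X0)).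
have DL : D <= #|G|%:R * L.
  rewrite mulr_natl -lnXn ?mulr_gt0 ?exprn_gt0 //.
  rewrite ler_ln ?posrE ?divr_gt0 ?exprn_gt0 ?mulr_gt0 ?exprn_gt0 //.
  have /andP[wl _] := wM G X0.
  rewrite ler_pdivrMr //; apply: (@le_trans _ _ (2 ^+ #|G| * M ^+ #|G|)).
    have -> : 2 ^+ #|G| = #|{set G}|%:R :> R.
      by rewrite -natrX -(cardsT G) -card_powerset powersetT cardsT.
    rewrite mulr_natl -sumr_const; apply: ler_sum => X _.
    by have /andP[] := wM G X.
  rewrite exprMn -mulrA ler_wpM2l ?exprn_ge0 //.
  rewrite -ler_pdivrMl ?exprn_gt0 ?exprn_gt0 //; apply: le_trans wl.
  by rewrite -exprM mul2n -addnn exprD invfM -mulrA mulVf ?mulr1 // gt_eqF ?exprn_gt0.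
pose r := 4 * #|G|%:R * A * (D + 2 * ln eps^-1).
have D0 : 0 <= D.
  rewrite ln_ge0 // ler_pdivlMr // mul1r /Z (bigD1 X0) //= ler_wpDr //.
  by apply: sumr_ge0 => X _; apply: ltW.
have r0 : 0 <= r.
  rewrite mulr_ge0 ?addr_ge0 // ?(mulr_ge0 _ (ltW A0)) ?mulr_ge0 //.
  by move: ell; lra.
exists (Num.trunc r).+1; split.
  apply: (tv_dist_iter_flip_chain w_pos G0 A0 PI) => //.
  rewrite ler_pdivlMr; last by rewrite mulr_gt0 // mulr_gt0 // ltr0n.
  rewrite mulrC; exact/ltW/truncnS_gt.
apply: (@le_trans _ _ (r + 1)); first by rewrite -natr1 lerD2r truncn_le.
have -> : bound = (4 * Q * (L + 1) + 2) * (#|G|%:R ^+ 2 * P) * ln eps^-1.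
  rewrite /bound /e powRD; last by rewrite (gt_eqF (lt_le_trans ltr01 n1)) implybT.
  by rewrite (powR_mulrn 2) ?ler0n.
move: n1 (ln eps^-1) ell DL AP P1 Q1 @r r0; rewrite -/P.
move: (#|G|%:R : R) P D D0 => n P D D0 n1 l ell DL AP P1 Q1 r _.
have P0 : 0 <= P by lra.
have n0 : 0 <= n by lra.
have l0 : 0 <= l by lra.
have n2 : n <= n ^+ 2 by rewrite expr2 ler_peMl.
(* Here [2 * l >= 1] absorbs the term without [l], and [n >= 1] the term without [n]. *)
have h1 : D + 2 * l <= n * (2 * (L + 1) * l).
  have a1 : n * L <= n * L * (2 * l) by rewrite ler_peMr ?mulr_ge0 //; lra.
  have a2 : 2 * l <= n * (2 * l) by rewrite ler_peMl ?mulr_ge0.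
  by move: DL a1 a2; lra.
have h2 : r <= 4 * n * (Q * P / 2) * (n * (2 * (L + 1) * l)).
  have n4 : 0 <= 4 * n by rewrite mulr_ge0.
  apply: ler_pM => //; first exact: mulr_ge0 n4 (ltW A0).
    by rewrite addr_ge0 // mulr_ge0.
  exact: ler_wpM2l.
have h3 : 1 <= 2 * (n ^+ 2 * P) * l.
  have : 1 <= n ^+ 2 * P by rewrite -[1]mulr1 ler_pM // exprn_ege1.
  by nra.
by move: h2 h3; lra.
Qed.
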